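(* Let $k$ be an algebraically closed field of arbitrary characteristic. If $H$ is a finite-dimensional cosemisimple involutive Hopf algebra over $k$ (that is, $S^2=\mathrm{id}$, where $S$ is the antipode of $H$) and $J$ is a twist for $H$, then the twisted Hopf algebra $H^J$ is also cosemisimple and involutive.
   Context: Let $\Delta,\varepsilon,S$ be the comultiplication, counit and antipode of $H$. A twist for $H$ is an invertible $J\in H\otimes H$ with $(\Delta\otimes\mathrm{id})(J)(J\otimes 1)=(\mathrm{id}\otimes\Delta)(J)(1\otimes J)$, normalized by $(\varepsilon\otimes\mathrm{id})(J)=(\mathrm{id}\otimes\varepsilon)(J)=1$. Write $J=J^{(1)}\otimes J^{(2)}$ (summation understood) and $Q_J=S(J^{(1)})J^{(2)}$, which is invertible. The twisted Hopf algebra $H^J$ has the same algebra structure and counit as $H$, comultiplication $\Delta^J(h)=J^{-1}\Delta(h)J$ and antipode $S^J(h)=Q_J^{-1}S(h)Q_J$. *)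

(* Defs.v *)
From HB Require Import structures.
From mathcomp Require Import all_boot all_order all_algebra all_field.
Set Implicit Arguments. Unset Strict Implicit. Unset Printing Implicit Defensive.
Import GRing.Theory.
Local Open Scope ring_scope.

(* The tensor product of two finite-dimensional spaces, represented by the    *)
(* matrix of coordinates on the bases vbasis {:U} and vbasis {:V}; tens u v   *)
(* is the pure tensor u (x) v. For bilinear f, tens_lift f is the induced     *)
(* linear map sending u (x) v to f u v (tens_liftE); with Sweedler's notation *)
(* t = t1 (x) t2, tens_lift (fun x y => E x y) t reads E t1 t2. Nothing is    *)
(* meant by tens_lift f when f is not bilinear.                               *)
Definition tensor (k : fieldType) (U V : vectType k) : Type :=
  'M[k]_(\dim {:U}, \dim {:V}).

HB.instance Definition _ (k : fieldType) (U V : vectType k) :=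
  Vector.copy (tensor U V) 'M[k]_(\dim {:U}, \dim {:V}).

Section Tensor.
Variables (k : fieldType) (U V : vectType k).

Definition tens (u : U) (v : V) : tensor U V :=
  \matrix_(i, j) (coord (vbasis {:U}) i u * coord (vbasis {:V}) j v).

Definition bilin (W : lmodType k) (f : U -> V -> W) :=
  (forall v, linear (f^~ v)) /\ (forall u, linear (f u)).

Definition tens_lift (W : lmodType k) (f : U -> V -> W) (t : tensor U V) : W :=
  \sum_i \sum_j t i j *: f (vbasis {:U})`_i (vbasis {:V})`_j.

Lemma tens_lift_is_linear W f : linear (@tens_lift W f).
Proof.
move=> a s t; rewrite /tens_lift scaler_sumr -big_split; apply: eq_bigr => i _ /=.
rewrite scaler_sumr -big_split; apply: eq_bigr => j _ /=.
by rewrite !mxE scalerDl scalerA.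
Qed.
HB.instance Definition _ (W : lmodType k) (f : U -> V -> W) :=
  GRing.isLinear.Build k (tensor U V) W *:%R
  (tens_lift f) (@tens_lift_is_linear W f).

Lemma tens_liftE (W : lmodType k) (f : U -> V -> W) u v :
  bilin f -> tens_lift f (tens u v) = f u v.
Proof.
case=> f1 f2.
pose F1 v := GRing.isLinear.Build _ _ _ _ _ (f1 v).
pose G1 v : {linear U -> W} := HB.pack (f^~ v) (F1 v).
pose F2 v := GRing.isLinear.Build _ _ _ _ _ (f2 v).
pose G2 v : {linear V -> W} := HB.pack (f v) (F2 v).
rewrite [u in RHS](coord_vbasis (memvf u)) -[RHS]/(G1 v _) linear_sum.
apply: eq_bigr => i _; rewrite linearZ /= -[f _ v]/(G2 _ v).
rewrite [v in RHS](coord_vbasis (memvf v)) linear_sum scaler_sumr.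
by apply: eq_bigr => j _; rewrite linearZ /= mxE scalerA.
Qed.

Lemma tens_bilin : bilin tens.
Proof.
split=> [v|u] a x y; apply/matrixP=> i j; rewrite !mxE linearP /=.
  by rewrite mulrDl mulrA.
by rewrite mulrDr mulrCA.
Qed.

Lemma tensDl x y v : tens (x + y) v = tens x v + tens y v.
Proof. by have := tens_bilin.1 v 1 x y; rewrite !scale1r. Qed.
Lemma tensDr x y u : tens u (x + y) = tens u x + tens u y.
Proof. by have := tens_bilin.2 u 1 x y; rewrite !scale1r. Qed.
Lemma tens0l v : tens 0 v = 0.
Proof. by apply: (addrI (tens 0 v)); rewrite -tensDl !addr0. Qed.
Lemma tens0r u : tens u 0 = 0.
Proof. by apply: (addrI (tens u 0)); rewrite -tensDr !addr0. Qed.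
Lemma tensZl a x v : tens (a *: x) v = a *: tens x v.
Proof. by have := tens_bilin.1 v a x 0; rewrite tens0l !addr0. Qed.
Lemma tensZr a x u : tens u (a *: x) = a *: tens u x.
Proof. by have := tens_bilin.2 u a x 0; rewrite tens0r !addr0. Qed.

Lemma tens_liftT t : tens_lift tens t = t.
Proof.
have cb (X : vectType k) (i j : 'I_(\dim {:X})) :
    coord (vbasis {:X}) i (vbasis {:X})`_j = (i == j)%:R.
  by rewrite coord_free ?(basis_free (vbasisP _)) // eq_sym.
apply/matrixP=> i j; rewrite /tens_lift summxE (bigD1 i) //= summxE.
rewrite (bigD1 j) //= !mxE !cb !eqxx !mulr1 !big1 ?addr0 // => [m|m] ne.
  by rewrite summxE big1 // => n _; rewrite !mxE !cb eq_sym (negPf ne) mul0r mulr0.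
by rewrite !mxE !cb eqxx mul1r eq_sym (negPf ne) mulr0.
Qed.

Lemma tensor_ind (P : tensor U V -> Prop) :
  (forall u v, P (tens u v)) -> (forall s t, P s -> P t -> P (s + t)) ->
  forall t, P t.
Proof.
move=> Pt PD t; rewrite -(tens_liftT t) /tens_lift.
have P0 : P 0 by rewrite -(tens0l 0).
apply: (big_ind P) => // i _; apply: (big_ind P) => // j _.
by rewrite -tensZl.
Qed.

Lemma tensorP t : exists s : seq (U * V), t = \sum_(p <- s) tens p.1 p.2.
Proof.
elim/tensor_ind: t => [u v|_ _ [s ->] [t ->]].
  by exists [:: (u, v)]; rewrite big_seq1.
by exists (s ++ t); rewrite big_cat.
Qed.

Lemma tens_lift_ext (W : lmodType k) (f g : U -> V -> W) t :
  (forall u v, f u v = g u v) -> tens_lift f t = tens_lift g t.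
Proof.
by move=> fg; apply: eq_bigr => i _; apply: eq_bigr => j _; rewrite fg.
Qed.

Lemma tens_lift_lin (W : lmodType k) (f g h : U -> V -> W) a t :
  (forall u v, f u v = a *: g u v + h u v) ->
  tens_lift f t = a *: tens_lift g t + tens_lift h t.
Proof.
move=> fE; rewrite /tens_lift scaler_sumr -big_split; apply: eq_bigr => i _ /=.
rewrite scaler_sumr -big_split; apply: eq_bigr => j _ /=.
by rewrite fE scalerDr !scalerA mulrC.
Qed.

Lemma tens_lift_comp (W W' : lmodType k) (f : U -> V -> W) (g : {linear W -> W'}) t :
  g (tens_lift f t) = tens_lift (fun u v => g (f u v)) t.
Proof.
rewrite linear_sum; apply: eq_bigr => i _; rewrite linear_sum.
by apply: eq_bigr => j _; rewrite linearZ.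
Qed.

Lemma tens_neq0 u v : u != 0 -> v != 0 -> tens u v != 0.
Proof.
move=> u0 v0; apply/eqP => uv0.
have coord0 (X : vectType k) (x : X) : x != 0 ->
    exists i, coord (vbasis {:X}) i x != 0.
  move=> x0; apply/existsP; apply: contraNT x0 => /existsPn/= h.
  rewrite (coord_vbasis (memvf x)) big1 // => i _.
  by have /negPn/eqP-> := h i; rewrite scale0r.
have [i ui] := coord0 _ _ u0; have [j vj] := coord0 _ _ v0.
have /matrixP/(_ i j) := uv0; rewrite !mxE => /eqP.
by rewrite mulf_eq0 (negPf ui) (negPf vj).
Qed.
End Tensor.

(* The ring structure is (a (x) b) (c (x) d) = ac (x) bd, see tensM. *)
Section TensorAlgebra.
Variables (k : fieldType) (A B : falgType k).
Local Notation T := (tensor A B).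
Implicit Types s t : T.

Definition tmul s t : T :=
  tens_lift (fun a b => tens_lift (fun c d => tens (a * c) (b * d)) t) s.
Definition tone : T := tens 1 1.

Fact tmul_lin2 s : linear (tmul s).
Proof.
by move=> x t u; apply: tens_lift_lin => a b; rewrite linearP.
Qed.
Fact tmul_tens a b c d : tmul (tens a b) (tens c d) = tens (a * c) (b * d).
Proof.
have H a' b' : bilin (fun c d => tens (a' * c) (b' * d)).
  by split=> ? ? ? ?; rewrite mulrDr -scalerAr ?(tensDl, tensZl, tensDr, tensZr).
rewrite /tmul tens_liftE ?tens_liftE //.
split=> [v|u] x y z; apply: tens_lift_lin => c' d'; rewrite mulrDl -scalerAl.
  by rewrite tensDl tensZl.
by rewrite tensDr tensZr.
Qed.
Fact tmulDl : left_distributive tmul +%R.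
Proof. by move=> s t u; rewrite /tmul linearD. Qed.
Fact tmulDr : right_distributive tmul +%R.
Proof. by move=> s t u; rewrite -[t]scale1r tmul_lin2 !scale1r. Qed.
Fact tmulA : associative tmul.
Proof.
move=> s t u; elim/tensor_ind: s => [a b|s s' IH IH']; last first.
  by rewrite !tmulDl IH IH'.
elim/tensor_ind: t => [c d|t t' IH IH']; last by rewrite !(tmulDl, tmulDr) IH IH'.
elim/tensor_ind: u => [e f|t t' IH IH']; last by rewrite !tmulDr IH IH'.
by rewrite !tmul_tens !mulrA.
Qed.
Fact tmul1l : left_id tone tmul.
Proof.
move=> u; elim/tensor_ind: u => [e f|t t' IH IH']; last by rewrite !tmulDr IH IH'.
by rewrite tmul_tens !mul1r.
Qed.
Fact tmul1r : right_id tone tmul.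
Proof.
move=> u; elim/tensor_ind: u => [e f|t t' IH IH']; last by rewrite !tmulDl IH IH'.
by rewrite tmul_tens !mulr1.
Qed.
Fact tone_neq0 : tone != 0.
Proof. by rewrite tens_neq0 ?oner_neq0. Qed.

HB.instance Definition _ := GRing.Zmodule_isNzRing.Build T
  tmulA tmul1l tmul1r tmulDl tmulDr tone_neq0.
Fact tscalerAl (a : k) s t : a *: (s * t) = a *: s * t.
Proof. by rewrite -[LHS]linearZ. Qed.
HB.instance Definition _ := GRing.Lmodule_isLalgebra.Build k T tscalerAl.
Fact tscalerAr (a : k) s t : a *: (s * t) = s * (a *: t).
Proof.
have sD : forall u, tmul s u = s * u by [].
by have := tmul_lin2 s a t 0; rewrite !sD mulr0 !addr0.
Qed.
HB.instance Definition _ := GRing.Lalgebra_isAlgebra.Build k T tscalerAr.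
HB.instance Definition _ := Algebra_isFalgebra.Build k T.

Lemma tensM a b c d : (tens a b : T) * tens c d = tens (a * c) (b * d).
Proof. exact: tmul_tens. Qed.
Lemma tens1 : tens 1 1 = 1 :> T. Proof. by []. Qed.
End TensorAlgebra.

(* f (x) g, for f and g linear. *)
Definition tens_map (k : fieldType) (U V U' V' : vectType k)
    (f : U -> U') (g : V -> V') : tensor U V -> tensor U' V' :=
  tens_lift (fun u v => tens (f u) (g v)).

Definition tens_assoc (k : fieldType) (U V W : vectType k) :
    tensor (tensor U V) W -> tensor U (tensor V W) :=
  tens_lift (fun t w => tens_lift (fun u v => tens u (tens v w)) t).

Definition tensv (k : fieldType) (U V : vectType k)
    (D : {vspace U}) (E : {vspace V}) : {vspace tensor U V} :=
  <<[seq tens x y | x <- vbasis D, y <- vbasis E]>>%VS.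

HB.instance Definition _ (k : fieldType) (U V U' V' : vectType k)
    (f : U -> U') (g : V -> V') := GRing.Linear.copy (tens_map f g)
  (tens_lift (fun u v => tens (f u) (g v))).

HB.instance Definition _ (k : fieldType) (U V W : vectType k) :=
  GRing.Linear.copy (@tens_assoc k U V W)
  (tens_lift (fun t w => tens_lift (fun u v => tens u (tens v w)) t)).

Local Ltac lin := repeat (let h := fresh in move=> h); rewrite /=;
  rewrite ?(mulrDl, mulrDr, =^~ scalerAl, =^~ scalerAr) ?linearP /=
          ?(mulrDl, mulrDr, =^~ scalerAl, =^~ scalerAr) ?scalerDr ?scalerDl.

Section TensorMaps.
Variable k : fieldType.

Lemma tens_mapE (U V U' V' : vectType k) (f : {linear U -> U'})
    (g : {linear V -> V'}) u v :
  tens_map f g (tens u v) = tens (f u) (g v).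
Proof.
rewrite /tens_map tens_liftE //.
by split=> [y|x] a b c; rewrite linearP ?(tensDl, tensDr) ?(tensZl, tensZr).
Qed.

Lemma tens_assocE (U V W : vectType k) (t : tensor U V) (w : W) :
  tens_assoc (tens t w) = tens_lift (fun u v => tens u (tens v w)) t.
Proof.
rewrite /tens_assoc tens_liftE //; split=> [y|x] a b c; first by rewrite linearP.
by apply: tens_lift_lin => u v; rewrite tensDr tensZr tensDr tensZr.
Qed.

Lemma tens_assoc_tens (U V W : vectType k) (u : U) (v : V) (w : W) :
  tens_assoc (tens (tens u v) w) = tens u (tens v w).
Proof.
rewrite tens_assocE tens_liftE //; split=> [y|x] a b c.
  by rewrite tensDl tensZl.
by rewrite tensDl tensDr tensZl tensZr.
Qed.

Lemma tens_lift_morph (A B : falgType k) (C : algType k) (f : A -> B -> C) :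
    bilin f -> (forall a b c d, f (a * c) (b * d) = f a b * f c d) ->
  {morph tens_lift f : s t / s * t}.
Proof.
move=> fb fM s t; elim/tensor_ind: s => [a b|s s' IH IH']; last first.
  by rewrite mulrDl !linearD /= mulrDl IH IH'.
elim/tensor_ind: t => [c d|t t' IH IH']; last first.
  by rewrite mulrDr !linearD /= mulrDr IH IH'.
by rewrite tensM !tens_liftE.
Qed.

Lemma tens_map_morph (A B A' B' : falgType k) (f : {lrmorphism A -> A'})
    (g : {lrmorphism B -> B'}) : {morph tens_map f g : s t / s * t}.
Proof.
apply: tens_lift_morph => [|a b c d]; last by rewrite !rmorphM tensM.
by split=> [y|x] a b c; rewrite linearP ?(tensDl, tensDr) ?(tensZl, tensZr).
Qed.

Lemma tens_assoc_morph (A B C : falgType k) :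
  {morph @tens_assoc k A B C : s t / s * t}.
Proof.
apply: tens_lift_morph => [|s c t d].
  split=> [y|x] a b c; first by rewrite linearP.
  by apply: tens_lift_lin => u v; rewrite tensDr tensZr tensDr tensZr.
rewrite -!tens_assocE -tensM.
elim/tensor_ind: s => [x y|s s' IH IH']; last first.
  by rewrite [tens (s + s') c]tensDl mulrDl !linearD /= mulrDl IH IH'.
elim/tensor_ind: t => [x' y'|t t' IH IH']; last first.
  by rewrite [tens (t + t') d]tensDl mulrDr !linearD /= mulrDr IH IH'.
by rewrite !tensM !tens_assoc_tens !tensM.
Qed.

Lemma tens_lift_mull (U V : vectType k) (A : algType k) (f : U -> V -> A) t a :
  a * tens_lift f t = tens_lift (fun u v => a * f u v) t.
Proof. exact: (tens_lift_comp f (a \*o @idfun A)). Qed.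

Lemma tens_lift_mulr (U V : vectType k) (A : algType k) (f : U -> V -> A) t a :
  tens_lift f t * a = tens_lift (fun u v => f u v * a) t.
Proof. exact: (tens_lift_comp f (a \o* @idfun A)). Qed.

Lemma tens_lift_scale (U V : vectType k) (A : lmodType k) (f : U -> V -> A) t a :
  a *: tens_lift f t = tens_lift (fun u v => a *: f u v) t.
Proof. exact: (tens_lift_comp f (a \*: @idfun A)). Qed.

Definition trilin (U V W : vectType k) (X : lmodType k) (f : U -> V -> W -> X) :=
  [/\ forall v w, linear (fun u => f u v w),
      forall u w, linear (fun v => f u v w) & forall u v, linear (f u v)].

Lemma falg_mul1_unit (A : falgType k) (x y : A) : x * y = 1 -> x \is a GRing.unit.
Proof.
move=> xy; pose f := amulr x.
have kf : lker f == 0%VS.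
  apply/lker0P=> v w; rewrite !lfunE /= => /(congr1 (fun z => z * y)).
  by rewrite -!mulrA xy !mulr1.
have [v vx] : exists v, v * x = 1.
  exists ((f^-1)%VF 1); have := lker0_lfunVK kf 1; by rewrite {1}/f lfunE.
apply/unitrP; exists v; split=> //.
by rewrite -[v]mulr1 -xy mulrA vx mul1r.
Qed.
End TensorMaps.

(* Hopf algebra structures on the finite-dimensional algebra A. *)
Record hopfAlgebra (k : fieldType) (A : falgType k) := HopfAlgebra {
  comul : {lrmorphism A -> tensor A A};
  counit : {lrmorphism A -> k | *%R};
  antipode : {linear A -> A};
  comulA : forall a,
    tens_assoc (tens_map comul idfun (comul a)) = tens_map idfun comul (comul a);
  counitl : forall a, tens_lift (fun x y => counit x *: y) (comul a) = a;
  counitr : forall a, tens_lift (fun x y => counit y *: x) (comul a) = a;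
  antipodel : forall a,
    tens_lift (fun x y => antipode x * y) (comul a) = counit a *: 1;
  antipoder : forall a,
    tens_lift (fun x y => x * antipode y) (comul a) = counit a *: 1
}.

Section Cosemisimple.
Variables (k : fieldType) (A : falgType k) (H : hopfAlgebra A).

Definition subcoalgebra (D : {vspace A}) : Prop :=
  forall d, d \in D -> comul H d \in tensv D D.

Definition simple_subcoalgebra (D : {vspace A}) : Prop :=
  [/\ D != 0%VS, subcoalgebra D &
      forall E, subcoalgebra E -> (E <= D)%VS -> E = 0%VS \/ E = D].

Definition cosemisimple : Prop :=
  exists (n : nat) (D : 'I_n -> {vspace A}),
    [/\ forall i, simple_subcoalgebra (D i), directv (\sum_i D i)%VS &
        (\sum_i D i)%VS = {:A}%VS].
End Cosemisimple.

(* The cocycle equation lives in A (x) (A (x) A). Its left-hand side is       *)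
(* computed in (A (x) A) (x) A, where J (x) 1 is a pure tensor, and moved     *)
(* along the associator, an algebra morphism (tens_assoc_morph).              *)
Record twist (k : fieldType) (A : falgType k) (H : hopfAlgebra A) := Twist {
  twist_val :> tensor A A;
  twist_unit : twist_val \is a GRing.unit;
  twist_cocycle :
    tens_assoc (tens_map (comul H) idfun twist_val * tens twist_val 1) =
    tens_map idfun (comul H) twist_val * tens 1 twist_val;
  twist_counitl : tens_lift (fun x y => counit H x *: y) twist_val = 1;
  twist_counitr : tens_lift (fun x y => counit H y *: x) twist_val = 1
}.

Section AntipodeTheory.
Variables (k : fieldType) (A : falgType k) (H : hopfAlgebra A).
Local Notation D := (comul H).
Local Notation eps := (counit H).
Local Notation S := (antipode H).

Lemma comul3 (W : lmodType k) (f : A -> A -> A -> W) a : trilin f ->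
  tens_lift (fun x z => tens_lift (fun x1 x2 => f x1 x2 z) (D x)) (D a) =
  tens_lift (fun x y => tens_lift (fun y1 y2 => f x y1 y2) (D y)) (D a).
Proof.
case=> f1 f2 f3; pose T3 := tens_lift (fun x s => tens_lift (f x) s).
have T3E x s : T3 (tens x s) = tens_lift (f x) s.
  rewrite /T3 tens_liftE //; split=> [y|z] b u v; last by rewrite linearP.
  by apply: tens_lift_lin => u' v'; rewrite f1.
have := congr1 T3 (comulA H a); rewrite /tens_map [tens_assoc _]tens_lift_comp /T3.
rewrite [LHS]tens_lift_comp [RHS]tens_lift_comp => e.
rewrite -[RHS](tens_lift_ext _ (fun x y => T3E x (D y))) -[RHS]e.
apply: tens_lift_ext => x z.
change (tens_lift (fun x1 x2 => f x1 x2 z) (D x) = T3 (tens_assoc (tens (D x) z))).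
rewrite tens_assocE /T3 tens_lift_comp; apply: tens_lift_ext => u v.
rewrite -[RHS]/(T3 _) T3E tens_liftE //.
Qed.


Let W y x := tens_lift (fun y1 y2 => y1 * S (x * y2)) (D y).

Let Wlin y : linear (W y).
Proof. by move=> a u v; apply: tens_lift_lin; lin. Qed.
HB.instance Definition _ y := GRing.isLinear.Build k A A *:%R (W y) (Wlin y).


Fact antipode_aux0 (s t : tensor A A) :
  tens_lift (fun x1 x2 => x1 * tens_lift (fun y1 y2 => y1 * S (x2 * y2)) t) s =
  tens_lift (fun x y => x * S y) (s * t).
Proof.
elim/tensor_ind: s => [a b|s s' IH IH']; last first.
  by rewrite mulrDl !linearD /= IH IH'.
rewrite tens_liftE; last first.
  split=> [y|x] u v w; first by lin.
  by rewrite scalerAr -mulrDr; congr (_ * _); apply: tens_lift_lin; lin.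
elim/tensor_ind: t => [c d|t t' IH IH']; last first.
  by rewrite mulrDr !linearD /= mulrDr IH IH'.
by rewrite tensM !tens_liftE ?mulrA //; split; lin.
Qed.

Fact antipode_aux1 x y :
  tens_lift (fun x1 x2 => x1 * W y x2) (D x) = (eps x * eps y) *: 1.
Proof. by rewrite antipode_aux0 -rmorphM antipoder rmorphM. Qed.

Fact antipode_aux2 x y : W y x = eps y *: S x.
Proof.
have := @comul3 A (fun a b c => S a * b * W y c) x; set L := LHS; set R := RHS.
have -> : L = W y x.
  rewrite -[x in RHS](counitl H) /L tens_lift_comp; apply: tens_lift_ext => u v.
  rewrite linearZ /= -[W y v in RHS]mul1r scalerAl -antipodel.
  by rewrite -tens_lift_mulr.
have -> : R = eps y *: S x.
  rewrite -[x in RHS](counitr H) /R [S _]tens_lift_comp tens_lift_scale.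
  apply: tens_lift_ext => u v.
  transitivity (S u * tens_lift (fun x1 x2 => x1 * W y x2) (D v)).
    by rewrite tens_lift_mull; apply: tens_lift_ext => a b /=; rewrite mulrA.
  by rewrite antipode_aux1 -scalerAr mulr1 linearZ /= scalerA mulrC.
by apply; split; lin.
Qed.

Lemma antipodeM x y : S (x * y) = S y * S x.
Proof.
have := @comul3 A (fun a b c => S a * b * S (x * c)) y; set L := LHS; set R := RHS.
have -> : L = S (x * y).
  rewrite -[y in RHS](counitl H) /L tens_lift_mull [S _]tens_lift_comp.
  apply: tens_lift_ext => u v.
  rewrite -scalerAr linearZ /= -[S (x * v) in RHS]mul1r scalerAl -antipodel.
  by rewrite -tens_lift_mulr.
have -> : R = S y * S x.
  rewrite -[y in RHS](counitr H) /R [S _]tens_lift_comp tens_lift_mulr.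
  apply: tens_lift_ext => u v; rewrite linearZ /= -scalerAl scalerAr.
  rewrite -antipode_aux2 tens_lift_mull.
  by apply: tens_lift_ext => a b /=; rewrite mulrA.
by apply; split; lin.
Qed.

Lemma antipode1 : S 1 = 1.
Proof.
have := antipodel H 1; rewrite !rmorph1 -tens1 tens_liftE; last by split; lin.
by rewrite mulr1 scale1r.
Qed.

(* S(t1) x t2 and t1 x S(t2) *)
Definition conv_l (x : A) := tens_lift (fun a b => S a * x * b).
Definition conv_r (x : A) := tens_lift (fun a b => a * x * S b).

Lemma conv_lE x a b : conv_l x (tens a b) = S a * x * b.
Proof. by rewrite /conv_l tens_liftE //; split; lin. Qed.
Lemma conv_rE x a b : conv_r x (tens a b) = a * x * S b.
Proof. by rewrite /conv_r tens_liftE //; split; lin. Qed.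
HB.instance Definition _ x := GRing.Linear.copy (conv_l x)
  (tens_lift (fun a b => S a * x * b)).
HB.instance Definition _ x := GRing.Linear.copy (conv_r x)
  (tens_lift (fun a b => a * x * S b)).
Lemma conv_lD x y s : conv_l (x + y) s = conv_l x s + conv_l y s.
Proof.
by rewrite -[conv_l x s]scale1r; apply: tens_lift_lin => a b; rewrite scale1r; lin.
Qed.
Lemma conv_rD x y s : conv_r (x + y) s = conv_r x s + conv_r y s.
Proof.
by rewrite -[conv_r x s]scale1r; apply: tens_lift_lin => a b; rewrite scale1r; lin.
Qed.

Lemma conv_l1 x : conv_l x 1 = x.
Proof. by rewrite -tens1 conv_lE antipode1 mul1r mulr1. Qed.
Lemma conv_r1 x : conv_r x 1 = x.
Proof. by rewrite -tens1 conv_rE antipode1 mul1r mulr1. Qed.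

Lemma conv_lM x s t : conv_l x (s * t) = conv_l (conv_l x s) t.
Proof.
elim/tensor_ind: s => [a b|s s' IH IH']; last first.
  by rewrite mulrDl !linearD /= conv_lD IH IH'.
elim/tensor_ind: t => [c d|t t' IH IH']; last by rewrite mulrDr !linearD /= IH IH'.
by rewrite tensM !conv_lE antipodeM !mulrA.
Qed.
Lemma conv_rM x s t : conv_r x (s * t) = conv_r (conv_r x t) s.
Proof.
elim/tensor_ind: t => [c d|t t' IH IH']; last first.
  by rewrite mulrDr !linearD /= conv_rD IH IH'.
elim/tensor_ind: s => [a b|s s' IH IH']; last by rewrite mulrDl !linearD /= IH IH'.
by rewrite tensM !conv_rE antipodeM !mulrA.
Qed.

Lemma conv_l_comul a : conv_l 1 (D a) = eps a *: 1.
Proof. by rewrite -antipodel; apply: tens_lift_ext => u v; rewrite mulr1. Qed.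
Lemma conv_r_comul a : conv_r 1 (D a) = eps a *: 1.
Proof. by rewrite -antipoder; apply: tens_lift_ext => u v; rewrite mulr1. Qed.

End AntipodeTheory.

Section Twist.
Variables (k : fieldType) (A : falgType k) (H : hopfAlgebra A) (J : twist H).
Local Notation D := (comul H).
Local Notation eps := (counit H).
Local Notation S := (antipode H).
Local Notation T3 := (tensor A (tensor A A)).

(* Q_J; its inverse is J^-(1) S(J^-(2)), see twist_eltV. *)
Definition twist_elt : A := tens_lift (fun x y => S x * y) J.

Definition twist_comul (a : A) : tensor A A :=
  (twist_val J)^-1 * comul H a * twist_val J.

Definition twist_antipode (a : A) : A := twist_elt^-1 * antipode H a * twist_elt.

Let Jt : tensor A A := J.
Let Ju : Jt \is a GRing.unit := twist_unit J.

Fact twist_eltE : twist_elt = conv_l H 1 J.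
Proof. by apply: tens_lift_ext => u v; rewrite mulr1. Qed.

Definition tw_D1 := tens_map D (@idfun A).
HB.instance Definition _ := GRing.Linear.copy tw_D1
  (tens_map D (@idfun A)).
Local Notation D1 := tw_D1.
Definition tw_D2 := tens_map (@idfun A) D.
HB.instance Definition _ := GRing.Linear.copy tw_D2
  (tens_map (@idfun A) D).
Local Notation D2 := tw_D2.
Definition tw_K := tens_lift (fun x => tens_lift (fun y z => S x * y * S z)).
HB.instance Definition _ := GRing.Linear.copy tw_K
  (tens_lift (fun x => tens_lift (fun y z => S x * y * S z))).
Local Notation K := tw_K.
Let KE x y z : K (tens x (tens y z)) = S x * y * S z.
Proof.
rewrite /tw_K tens_liftE; last first.
  split=> [s|w] a u v; last by rewrite linearP.
  by apply: tens_lift_lin; lin.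
by rewrite tens_liftE //; split; lin.
Qed.
Let K1 s t : K (tens_assoc (tens s 1) * tens 1 t) = conv_l H 1 s * conv_r H 1 t.
Proof.
elim/tensor_ind: s => [a b|s s' IH IH']; last first.
  by rewrite tensDl linearD /= mulrDl !linearD /= mulrDl IH IH'.
elim/tensor_ind: t => [c d|t t' IH IH']; last first.
  by rewrite tensDr mulrDr !linearD /= mulrDr IH IH'.
rewrite tens_assoc_tens !tensM KE conv_lE conv_rE !mulr1 mul1r !mulrA //.
Qed.
Let K2 p b c q :
  K (tens_assoc (tens p b) * tens c q) = S c * conv_l H 1 p * conv_r H 1 q * S b.
Proof.
elim/tensor_ind: p => [u v|s s' IH IH']; last first.
  by rewrite tensDl linearD /= mulrDl !linearD /= mulrDr !mulrDl IH IH'.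
elim/tensor_ind: q => [u' v'|t t' IH IH']; last first.
  by rewrite tensDr mulrDr !linearD /= mulrDr mulrDl IH IH'.
by rewrite tens_assoc_tens !tensM KE conv_lE conv_rE !mulr1 !antipodeM !mulrA.
Qed.


Definition tw_epsl := tens_lift (fun x y : A => eps x *: y).
HB.instance Definition _ := GRing.Linear.copy tw_epsl
  (tens_lift (fun x y : A => eps x *: y)).
Local Notation epsl := tw_epsl.
Definition tw_epsr := tens_lift (fun x y : A => eps y *: x).
HB.instance Definition _ := GRing.Linear.copy tw_epsr
  (tens_lift (fun x y : A => eps y *: x)).
Local Notation epsr := tw_epsr.

Let epslE x y : epsl (tens x y) = eps x *: y.
Proof. by rewrite /tw_epsl tens_liftE //; split; lin; rewrite ?scalerA // mulrC. Qed.
Let epsrE x y : epsr (tens x y) = eps y *: x.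
Proof. by rewrite /tw_epsr tens_liftE //; split; lin; rewrite ?scalerA // mulrC. Qed.
Let epslM : {morph epsl : s t / s * t}.
Proof.
apply: tens_lift_morph => [|a b c d]; last first.
  by rewrite rmorphM -scalerAl -scalerAr scalerA.
by split; lin; rewrite ?scalerA // mulrC.
Qed.
Let epsrM : {morph epsr : s t / s * t}.
Proof.
apply: tens_lift_morph => [|a b c d]; last first.
  by rewrite rmorphM -scalerAl -scalerAr scalerA.
by split; lin; rewrite ?scalerA // mulrC.
Qed.
Let epsl1 : epsl 1 = 1.
Proof. by rewrite -tens1 epslE rmorph1 scale1r. Qed.
Let epsr1 : epsr 1 = 1.
Proof. by rewrite -tens1 epsrE rmorph1 scale1r. Qed.
Let epslJ : epsl Jt = 1. Proof. exact: twist_counitl. Qed.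
Let epsrJ : epsr Jt = 1. Proof. exact: twist_counitr. Qed.
Let epslJV : epsl Jt^-1 = 1.
Proof. by rewrite -[LHS]mulr1 -{1}epslJ -epslM mulVr. Qed.
Let epsrJV : epsr Jt^-1 = 1.
Proof. by rewrite -[LHS]mulr1 -{1}epsrJ -epsrM mulVr. Qed.

Let D1E x y : tens_assoc (D1 (tens x y)) = tens_assoc (tens (D x) y).
Proof. by rewrite /tw_D1 tens_mapE. Qed.
Let D2E x y : D2 (tens x y) = tens x (D y).
Proof. by rewrite /tw_D2 tens_mapE. Qed.
Let D1M : {morph D1 : s t / s * t}. Proof. exact: tens_map_morph. Qed.
Let D2M : {morph D2 : s t / s * t}. Proof. exact: tens_map_morph. Qed.
Let D11 : D1 1 = 1.
Proof. by rewrite -tens1 /D1 tens_mapE rmorph1. Qed.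
Let D21 : D2 1 = 1.
Proof. by rewrite -tens1 /D2 tens_mapE /= rmorph1. Qed.
Let Phi1 : tens_assoc (1 : tensor (tensor A A) A) = 1.
Proof. by rewrite -!tens1 tens_assoc_tens. Qed.

Let K3 s t : K (tens_assoc (D1 s) * D2 t) = S (epsr t) * S (epsl s).
Proof.
elim/tensor_ind: s => [a b|s s' IH IH']; last first.
  by rewrite !linearD /= mulrDl !linearD /= mulrDr IH IH'.
elim/tensor_ind: t => [c d|t t' IH IH']; last first.
  by rewrite !linearD /= mulrDr !linearD /= mulrDl IH IH'.
rewrite D1E D2E K2 conv_l_comul conv_r_comul epslE epsrE !linearZ /=.
by rewrite -!(scalerAl, scalerAr) !mulr1.
Qed.

Let cocycle : tens_assoc (D1 Jt) * tens_assoc (tens Jt (1 : A)) = D2 Jt * tens (1 : A) Jt.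
Proof. by have := twist_cocycle J; rewrite tens_assoc_morph. Qed.

Let tens1rM (s t : tensor A A) : tens (s * t) (1 : A) = tens s 1 * tens t 1.
Proof. by rewrite tensM mulr1. Qed.
Let tens1lM (s t : tensor A A) : tens (1 : A) (s * t) = tens 1 s * tens 1 t.
Proof. by rewrite tensM mulr1. Qed.

Let D1V : tens_assoc (D1 Jt^-1) * tens_assoc (D1 Jt) = 1.
Proof. by rewrite -tens_assoc_morph -D1M mulVr // D11 Phi1. Qed.
Let D2V : D2 Jt^-1 * D2 Jt = 1.
Proof. by rewrite -D2M mulVr // D21. Qed.
Let PV : tens_assoc (tens Jt^-1 (1 : A)) * tens_assoc (tens Jt (1 : A)) = 1.
Proof. by rewrite -tens_assoc_morph -tens1rM mulVr // tens1 Phi1. Qed.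
Let QV : tens (1 : A) Jt^-1 * tens (1 : A) Jt = 1.
Proof. by rewrite -tens1lM mulVr // tens1. Qed.
Let QV' : tens (1 : A) Jt * tens (1 : A) Jt^-1 = 1.
Proof. by rewrite -tens1lM mulrV // tens1. Qed.

Let cocycleV : tens_assoc (tens Jt^-1 (1 : A)) * tens_assoc (D1 Jt^-1)
               = tens (1 : A) Jt^-1 * D2 Jt^-1.
Proof.
set x := LHS; set y := RHS; set z := D2 Jt * tens (1 : A) Jt.
have xz : x * z = 1 by rewrite /z -cocycle mulrA -(mulrA _ _ (_ (D1 Jt))) D1V mulr1 PV.
have yz : y * z = 1 by rewrite mulrA -(mulrA _ _ (D2 Jt)) D2V mulr1 QV.
have zy : z * y = 1.
  rewrite mulrA -(mulrA _ (tens (1 : A) Jt)) QV' mulr1 -D2M mulrV // D21 //.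
by rewrite -[x]mulr1 -zy mulrA xz mul1r.
Qed.

Lemma twist_elt_inv : twist_elt * conv_r H 1 (Jt^-1) = 1.
Proof.
rewrite twist_eltE -K1.
have -> : tens_assoc (tens Jt (1 : A)) * tens (1 : A) Jt^-1 = tens_assoc (D1 Jt^-1) * D2 Jt.
  rewrite -[LHS]mul1r -D1V -(mulrA _ (tens_assoc (D1 Jt))) (mulrA (tens_assoc (D1 Jt))).
  by rewrite cocycle -(mulrA _ (tens (1 : A) Jt)) QV' mulr1.
by rewrite K3 epslJV epsrJ antipode1 mulr1.
Qed.

Lemma twist_elt_unit : twist_elt \is a GRing.unit.
Proof. exact: falg_mul1_unit twist_elt_inv. Qed.

Lemma twist_eltV : twist_elt^-1 = conv_r H 1 (Jt^-1).
Proof. by apply: (mulrI twist_elt_unit); rewrite mulrV ?twist_elt_unit // twist_elt_inv. Qed.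

Fact twist_comul_is_linear : linear twist_comul.
Proof. by move=> a x y; rewrite /twist_comul linearP mulrDr mulrDl -scalerAr -scalerAl. Qed.
HB.instance Definition _ := GRing.isLinear.Build k A (tensor A A) *:%R
  twist_comul twist_comul_is_linear.
Fact twist_comul_is_monoid_morphism : monoid_morphism twist_comul.
Proof.
split=> [|x y]; rewrite /twist_comul ?rmorph1 ?mulr1 ?mulVr //.
by rewrite rmorphM !mulrA mulrK.
Qed.
HB.instance Definition _ := GRing.isMonoidMorphism.Build A (tensor A A)
  twist_comul twist_comul_is_monoid_morphism.

Fact twist_antipode_is_linear : linear twist_antipode.
Proof. by move=> a x y; rewrite /twist_antipode linearP mulrDr mulrDl -scalerAr -scalerAl. Qed.
HB.instance Definition _ := GRing.isLinear.Build k A A *:%R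
  twist_antipode twist_antipode_is_linear.

Fact twist_comulA a : tens_assoc (tens_map twist_comul idfun (twist_comul a)) =
  tens_map idfun twist_comul (twist_comul a).
Proof.
have L s : tens_map twist_comul (@idfun A) s = tens Jt^-1 (1 : A) * D1 s * tens Jt (1 : A).
  elim/tensor_ind: s => [x y|s t IH IH'].
    by rewrite /tw_D1 !tens_mapE !tensM !mul1r !mulr1.
  by rewrite !linearD /= mulrDr mulrDl IH IH'.
have R s : tens_map (@idfun A) twist_comul s = tens (1 : A) Jt^-1 * D2 s * tens (1 : A) Jt.
  elim/tensor_ind: s => [x y|s t IH IH'].
    by rewrite /tw_D2 !tens_mapE !tensM !mul1r !mulr1.
  by rewrite !linearD /= mulrDr mulrDl IH IH'.
rewrite L R /twist_comul !D1M !D2M !tens_assoc_morph !mulrA cocycleV.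
rewrite -!mulrA cocycle.
have -> : tens_assoc (D1 (D a)) = D2 (D a) by exact: comulA.
by [].
Qed.

Fact twist_counitl' a : tens_lift (fun x y => eps x *: y) (twist_comul a) = a.
Proof.
rewrite -/(epsl _) /twist_comul !epslM epslJV mul1r epslJ mulr1.
exact: counitl.
Qed.
Fact twist_counitr' a : tens_lift (fun x y => eps y *: x) (twist_comul a) = a.
Proof.
rewrite -/(epsr _) /twist_comul !epsrM epsrJV mul1r epsrJ mulr1.
exact: counitr.
Qed.

Let conv_lZ x a s : conv_l H (a *: x) s = a *: conv_l H x s.
Proof.
by rewrite /conv_l tens_lift_scale; apply: tens_lift_ext => u v; rewrite -scalerAr -scalerAl.
Qed.
Let conv_rZ x a s : conv_r H (a *: x) s = a *: conv_r H x s.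
Proof.
by rewrite /conv_r tens_lift_scale; apply: tens_lift_ext => u v; rewrite -scalerAr -scalerAl.
Qed.

Fact twist_antipodel a :
  tens_lift (fun x y => twist_antipode x * y) (twist_comul a) = eps a *: 1.
Proof.
transitivity (twist_elt^-1 * conv_l H twist_elt (twist_comul a)).
  by rewrite tens_lift_mull; apply: tens_lift_ext => u v; rewrite !mulrA.
have e : conv_l H twist_elt Jt^-1 = 1.
  by rewrite twist_eltE -conv_lM mulrV // conv_l1.
rewrite /twist_comul !conv_lM e conv_l_comul conv_lZ.
by rewrite -twist_eltE -scalerAr mulVr ?twist_elt_unit.
Qed.

Fact twist_antipoder a :
  tens_lift (fun x y => x * twist_antipode y) (twist_comul a) = eps a *: 1.
Proof.
transitivity (conv_r H twist_elt^-1 (twist_comul a) * twist_elt).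
  by rewrite tens_lift_mulr; apply: tens_lift_ext => u v; rewrite !mulrA.
have e : conv_r H twist_elt^-1 Jt = 1.
  by rewrite twist_eltV -conv_rM mulrV // conv_r1.
rewrite /twist_comul !conv_rM e conv_r_comul conv_rZ.
by rewrite -twist_eltV -scalerAl mulVr ?twist_elt_unit.
Qed.

(* H^J, on the algebra A of H *)
Definition twisted : hopfAlgebra A := {|
  comul := twist_comul;
  counit := counit H;
  antipode := twist_antipode;
  comulA := twist_comulA;
  counitl := twist_counitl';
  counitr := twist_counitr';
  antipodel := twist_antipodel;
  antipoder := twist_antipoder
|}.
End Twist.

(* Main.v *)
Require Import Defs.
From HB Require Import structures.
From mathcomp Require Import all_boot all_order all_algebra all_field.
From Stdlib Require Import Classical_Prop.
Set Implicit Arguments. Unset Strict Implicit. Unset Printing Implicit Defensive.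
Import GRing.Theory.
Local Open Scope ring_scope.

(** Call f : {scalar A} an integral when h1 f(h2) = f(h) 1 for all h and
    f 1 = 1, in Sweedler's notation D h = h1 (x) h2. The theorem follows from
    the fact that an integral of H is still an integral of H^J, together with a
    correspondence between integrals and cosemisimplicity.

    If H is cosemisimple, the line of 1 is one of its simple summands and the
    projection onto it along the others is an integral (cosemisimple_integral).
    An integral f satisfies f o S = f and is two-sided, and if S is involutive
    then f (a b) = f (b a) (integral_trace): the forms f (a S b) and f (S b a)
    are both symmetric separability idempotents of the dual algebra, and there
    is at most one of those.

    Now let Q be the twist element. Using the trace property and the invariance
    of f, the legs of J and of its inverse in h1 f(h2), computed for the twisted
    comultiplication, can be moved onto each other (slice2_comul_conj); by the
    cocycle equation they collapse to
      (S x (x) 1) D y = (Q (x) 1) J^-1       for J = x (x) y,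
      D q (S p (x) 1) = J (S Q^-1 (x) 1)     for J^-1 = p (x) q
    (twist_comul_l, twist_comul_r), so that h1 f(h2) = f(h) S (Q S Q^-1) in H^J.
    At h = 1 the left-hand side is 1. Hence S Q = Q, which makes the antipode
    of H^J, the conjugate of S by Q, an involution, and then the same formula
    says that f is an integral of H^J.

    Finally, if f is an integral and S is involutive, the symmetric form
    f (a S b) gives every subcoalgebra B a complement, its orthogonal, which is
    a subcoalgebra (orth_subcoalgebra, orth_compl). Splitting off simple
    subcoalgebras one by one proves cosemisimplicity
    (integral_cosemisimple). *)

(* Proves the linearity conditions of bilin and trilin. *)
Local Ltac lin := repeat (let h := fresh in move=> h); rewrite /=;
  rewrite ?(mulrDl, mulrDr, =^~ scalerAl, =^~ scalerAr, linearP) /=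
          ?(tensDl, tensDr, tensZl, tensZr)
          ?(mulrDl, mulrDr, =^~ scalerAl, =^~ scalerAr) ?linearP /=
          ?scalerDr ?scalerDl ?scalerA.

(** * Slicing tensors by linear forms *)

Section Slices.
Variables (k : fieldType) (U V : vectType k).
Implicit Types (t : tensor U V) (phi : {scalar U}) (psi : {scalar V}).

(** For t = t1 (x) t2, these are phi(t1) t2 and psi(t2) t1. *)
Definition slice1 phi : tensor U V -> V := tens_lift (fun u v => phi u *: v).
Definition slice2 psi : tensor U V -> U := tens_lift (fun u v => psi v *: u).

HB.instance Definition _ phi := GRing.Linear.copy (slice1 phi)
  (tens_lift (fun u v => phi u *: v)).
HB.instance Definition _ psi := GRing.Linear.copy (slice2 psi)
  (tens_lift (fun u v => psi v *: u)).

Lemma slice1E phi u v : slice1 phi (tens u v) = phi u *: v.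
Proof.
rewrite /slice1 tens_liftE //; split=> [w|w] a x y; rewrite linearP ?scalerDl //.
by rewrite scalerA.
Qed.

Lemma slice2E psi u v : slice2 psi (tens u v) = psi v *: u.
Proof.
rewrite /slice2 tens_liftE //; split=> [w|w] a x y; rewrite linearP ?scalerDl //.
by rewrite scalerA.
Qed.

Lemma scalar_lift_eq (W W' : lmodType k) (f : {scalar W}) (g : {scalar W'})
    (F : U -> V -> W) (G : U -> V -> W') t :
  (forall u v, f (F u v) = g (G u v)) ->
  f (tens_lift F t) = g (tens_lift G t).
Proof.
move=> fg; rewrite !linear_sum /=; apply: eq_bigr => i _; rewrite !linear_sum.
by apply: eq_bigr => j _; rewrite !linearZ /= fg.
Qed.

Lemma tens_suml I (r : seq I) (P : pred I) (F : I -> U) v :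
  @tens k U V (\sum_(i <- r | P i) F i) v = \sum_(i <- r | P i) tens (F i) v.
Proof. by elim/big_rec2: _ => [|i x y _ <-]; rewrite ?tens0l ?tensDl. Qed.

Lemma tens_sumr I (r : seq I) (P : pred I) u (F : I -> V) :
  @tens k U V u (\sum_(i <- r | P i) F i) = \sum_(i <- r | P i) tens u (F i).
Proof. by elim/big_rec2: _ => [|i x y _ <-]; rewrite ?tens0r ?tensDr. Qed.

Lemma tens_lift_tensl (X Y : vectType k) (F : X -> Y -> U) s v :
  @tens k U V (tens_lift F s) v = tens_lift (fun x y => tens (F x y) v) s.
Proof.
rewrite tens_suml; apply: eq_bigr => i _; rewrite tens_suml.
by apply: eq_bigr => j _; rewrite tensZl.
Qed.

Lemma tens_lift_tensr (X Y : vectType k) u (F : X -> Y -> V) s :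
  @tens k U V u (tens_lift F s) = tens_lift (fun x y => tens u (F x y)) s.
Proof.
rewrite tens_sumr; apply: eq_bigr => i _; rewrite tens_sumr.
by apply: eq_bigr => j _; rewrite tensZr.
Qed.

Lemma memv_tens (D : {vspace U}) (E : {vspace V}) u v :
  u \in D -> v \in E -> tens u v \in tensv D E.
Proof.
move=> /coord_vbasis-> /coord_vbasis->; rewrite tens_suml memv_suml // => i _.
rewrite tens_sumr memv_suml // => j _; rewrite tensZl tensZr !memvZ //.
apply: memv_span; apply/allpairsP; exists ((vbasis D)`_i, (vbasis E)`_j).
by split=> //; rewrite mem_nth ?size_tuple.
Qed.

Lemma tensv_eq0 (W : lmodType k) (f : {linear tensor U V -> W})
    (D : {vspace U}) (E : {vspace V}) t :
  (forall u v, u \in D -> v \in E -> f (tens u v) = 0) ->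
  t \in tensv D E -> f t = 0.
Proof.
move=> f0 /(coord_span (X := in_tuple _))->.
rewrite linear_sum big1 //= => i _; rewrite linearZ /=.
have /allpairsP[[u v] /= [/vbasis_mem uD /vbasis_mem vE ->]] :
  [seq tens x y | x <- vbasis D, y <- vbasis E]`_i \in
  [seq tens x y | x <- vbasis D, y <- vbasis E] by apply: mem_nth.
by rewrite f0 // scaler0.
Qed.

Lemma tensor_slice1 t :
  t = \sum_(i < \dim {:U}) tens (vbasis {:U})`_i (slice1 (coord (vbasis {:U}) i) t).
Proof.
elim/tensor_ind: t => [u v|s t {1}-> {1}->].
  rewrite {1}[u](coord_vbasis (memvf u)) tens_suml; apply: eq_bigr => i _.
  by rewrite slice1E tensZl tensZr.
by rewrite -big_split; apply: eq_bigr => i _; rewrite linearD tensDr.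
Qed.

Lemma tensor_slice2 t :
  t = \sum_(i < \dim {:V}) tens (slice2 (coord (vbasis {:V}) i) t) (vbasis {:V})`_i.
Proof.
elim/tensor_ind: t => [u v|s t {1}-> {1}->].
  rewrite {1}[v](coord_vbasis (memvf v)) tens_sumr; apply: eq_bigr => i _.
  by rewrite slice2E tensZl tensZr.
by rewrite -big_split; apply: eq_bigr => i _; rewrite linearD tensDl.
Qed.

(** For the converse, expanding t along a basis of V shows that a projection
    onto D, applied on the left, fixes t; expanding along a basis of U then
    exhibits t as a sum of elements of D (x) E. *)
Lemma tensvP (D : {vspace U}) (E : {vspace V}) t :
  t \in tensv D E <->
  (forall phi, slice1 phi t \in E) /\ (forall psi, slice2 psi t \in D).
Proof.
split=> [tDE|[tE tD]].
  split=> f.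
    suff -> : slice1 f t = projv E (slice1 f t) by apply: memv_proj.
    apply/eqP; rewrite -subr_eq0; apply/eqP.
    pose g : {linear _ -> _} := (\1%VF - projv E)%VF \o slice1 f.
    have -> : slice1 f t - projv E (slice1 f t) = g t.
      by rewrite /g /= !lfun_simp.
    apply: tensv_eq0 tDE => u v _ vE; rewrite /g /= slice1E !lfun_simp.
    by rewrite projv_id ?subrr // memvZ.
  suff -> : slice2 f t = projv D (slice2 f t) by apply: memv_proj.
  apply/eqP; rewrite -subr_eq0; apply/eqP.
  pose g : {linear _ -> _} := (\1%VF - projv D)%VF \o slice2 f.
  have -> : slice2 f t - projv D (slice2 f t) = g t.
    by rewrite /g /= !lfun_simp.
  apply: tensv_eq0 tDE => u v uD _; rewrite /g /= slice2E !lfun_simp.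
  by rewrite projv_id ?subrr // memvZ.
suff -> : t = tens_map (projv D) idfun t.
  rewrite [t]tensor_slice1 linear_sum /= memv_suml // => i _.
  by rewrite tens_mapE; apply: memv_tens; [apply: memv_proj|apply: tE].
rewrite [t]tensor_slice2 linear_sum /=; apply: eq_bigr => i _.
by rewrite tens_mapE /= projv_id.
Qed.
End Slices.

(** * Integrals on a Hopf algebra *)

Section SliceProducts.
Variables (k : fieldType) (A : falgType k).
Implicit Types (t : tensor A A) (f : {scalar A}).

Lemma slice2_mull f a t : slice2 f (tens a 1 * t) = a * slice2 f t.
Proof.
elim/tensor_ind: t => [u v|s t IH IH']; last by rewrite mulrDr !linearD /= mulrDr IH IH'.
by rewrite tensM !slice2E mul1r scalerAr.
Qed.

Lemma slice2_mulr f a t : slice2 f (t * tens a 1) = slice2 f t * a.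
Proof.
elim/tensor_ind: t => [u v|s t IH IH']; last by rewrite mulrDl !linearD /= mulrDl IH IH'.
by rewrite tensM !slice2E mulr1 scalerAl.
Qed.

Lemma slice1_mulr f a t : slice1 f (t * tens 1 a) = slice1 f t * a.
Proof.
elim/tensor_ind: t => [u v|s t IH IH']; last by rewrite mulrDl !linearD /= mulrDl IH IH'.
by rewrite tensM !slice1E mulr1 scalerAl.
Qed.

End SliceProducts.

Section Integral.
Variables (k : fieldType) (A : falgType k) (H : hopfAlgebra A).
Local Notation D := (comul H).
Local Notation eps := (counit H).
Local Notation S := (antipode H).

Lemma comul_antipode_r y :
  tens_lift (fun y1 y2 => D y1 * tens 1 (S y2)) (D y) = tens y 1.
Proof.
have tri : trilin (fun x1 x2 z : A => tens x1 (x2 * S z)) by split; lin.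
transitivity (tens_lift (fun x z =>
    tens_lift (fun x1 x2 => tens x1 (x2 * S z)) (D x)) (D y)).
  apply: tens_lift_ext => u v; rewrite -[in LHS](tens_liftT (D u)) tens_lift_mulr.
  by apply: tens_lift_ext => u1 u2 /=; rewrite tensM mulr1.
rewrite (comul3 H y tri) -[in RHS](counitr H y) tens_lift_tensl.
apply: tens_lift_ext => u v.
by rewrite -tens_lift_tensr antipoder tensZl tensZr.
Qed.

(** Indeed D (S b1) (b2 (x) 1) = D (S b1) (b2 (x) b3 S b4)
    = D (S b1 b2) (1 (x) S b3). This is all that is needed of the fact that S
    reverses the comultiplication. *)
Lemma comul_antipode b :
  tens_lift (fun x y => D (S x) * tens y 1) (D b) = tens 1 (S b).
Proof.
have tri : trilin (fun x1 x2 z : A => D (S x1 * x2) * tens 1 (S z)).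
  split=> u v a x y; rewrite ?(linearP S) ?(mulrDl, mulrDr) -?(scalerAl, scalerAr).
  - by rewrite linearP mulrDl -scalerAl.
  - by rewrite linearP mulrDl -scalerAl.
  - by rewrite tensDr tensZr mulrDr -scalerAr.
transitivity (tens_lift (fun x y => tens_lift
    (fun y1 y2 => D (S x * y1) * tens 1 (S y2)) (D y)) (D b)).
  apply: tens_lift_ext => x y; rewrite -comul_antipode_r tens_lift_mull.
  by apply: tens_lift_ext => y1 y2 /=; rewrite rmorphM mulrA.
rewrite -(comul3 H b tri) -[in RHS](counitl H b) (tens_lift_comp _ S).
rewrite tens_lift_tensr; apply: tens_lift_ext => x z.
rewrite -tens_lift_mulr -(tens_lift_comp _ D) antipodel !linearZ /= rmorph1.
by rewrite -scalerAl mul1r tensZr.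
Qed.

Variable f : {scalar A}.
Hypothesis f_inv : forall h, slice2 f (D h) = f h *: 1.
Hypothesis f1 : f 1 = 1.

(** By invariance f (a S b1) b2 is the slice of D a D (S b1) (b2 (x) 1), to which
    comul_antipode applies. *)
Lemma integral_antipode_r a b :
  slice2 f (D a * tens 1 (S b)) = tens_lift (fun x y => f (a * S x) *: y) (D b).
Proof.
rewrite -comul_antipode tens_lift_mull (tens_lift_comp _ (slice2 f)).
apply: tens_lift_ext => x y /=.
by rewrite mulrA -rmorphM slice2_mulr f_inv -scalerAl mul1r.
Qed.

(** The case a = 1 above says that f o S is left invariant, so that
    f (S b1) f b2 = f (S b); right invariance of f gives f (S b1) f b2 = f b. *)
Lemma integral_antipode b : f (S b) = f b.
Proof.
have e : f (S b) *: 1 = tens_lift (fun x y => f (S x) *: y) (D b).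
  have := integral_antipode_r 1 b; rewrite rmorph1 mul1r slice2E => ->.
  by apply: tens_lift_ext => x y; rewrite mul1r.
have := congr1 f e; rewrite linearZ /= f1 mulr1 => ->.
rewrite -[RHS]mulr1 -f1 -(antipode1 H) -[in RHS]linearZ /= -linearZ /=.
rewrite -f_inv (tens_lift_comp _ S).
by apply: scalar_lift_eq => x y /=; rewrite !linearZ /= mulrC.
Qed.

Lemma integral_left h : slice1 f (D h) = f h *: 1.
Proof.
have := integral_antipode_r 1 h; rewrite rmorph1 mul1r slice2E.
rewrite integral_antipode => ->; apply: tens_lift_ext => x y.
by rewrite mul1r integral_antipode.
Qed.

(** In Sweedler's notation a1 f (c a2) = S c1 (c2 a1) f (c3 a2) = S c1 f (c2 a). *)
Lemma integral_slide2 c a :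
  slice2 f (tens 1 c * D a) = tens_lift (fun x y => f (y * a) *: S x) (D c).
Proof.
have tri : trilin (fun x1 x2 z : A => S x1 * slice2 f (tens x2 z * D a)).
  split=> u v b x y; rewrite ?(linearP S) ?(tensDl, tensDr) ?(tensZl, tensZr).
  - by rewrite mulrDl -scalerAl.
  - by rewrite mulrDl -scalerAl linearP mulrDr -scalerAr.
  - by rewrite mulrDl -scalerAl linearP mulrDr -scalerAr.
transitivity (tens_lift (fun x y =>
    tens_lift (fun y1 y2 => S x * slice2 f (tens y1 y2 * D a)) (D y)) (D c)).
  rewrite -(comul3 H c tri) -[in LHS](counitl H c) tens_lift_tensr tens_lift_mulr.
  rewrite (tens_lift_comp _ (slice2 f)); apply: tens_lift_ext => x z /=.
  rewrite tensZr -scalerAl linearZ /= -[slice2 _ _]mul1r scalerAl -antipodel.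
  rewrite tens_lift_mulr; apply: tens_lift_ext => x1 x2 /=.
  by rewrite -mulrA -(slice2_mull _ x2) mulrA tensM mulr1 mul1r.
apply: tens_lift_ext => x y.
rewrite -tens_lift_mull -(tens_lift_comp _ (slice2 f)) -tens_lift_mulr.
by rewrite tens_liftT -rmorphM /= f_inv -scalerAr mulr1.
Qed.

(** The mirror image f (a1 c) a2 = f (a c1) S c2, from left invariance. *)
Lemma integral_slide1 c a :
  slice1 f (D a * tens c 1) = tens_lift (fun x y => f (a * x) *: S y) (D c).
Proof.
have tri : trilin (fun z x1 x2 : A => slice1 f (D a * tens z x1) * S x2).
  split=> u v b x y; rewrite ?(linearP S) ?(tensDl, tensDr) ?(tensZl, tensZr).
  - by rewrite mulrDr -scalerAr linearP mulrDl -scalerAl.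
  - by rewrite mulrDr -scalerAr linearP mulrDl -scalerAl.
  - by rewrite mulrDr -scalerAr.
transitivity (tens_lift (fun x z =>
    tens_lift (fun x1 x2 => slice1 f (D a * tens x1 x2) * S z) (D x)) (D c)).
  rewrite (comul3 H c tri) -[in LHS](counitr H c) tens_lift_tensl tens_lift_mull.
  rewrite (tens_lift_comp _ (slice1 f)); apply: tens_lift_ext => z x /=.
  rewrite tensZl -scalerAr linearZ /= -[slice1 _ _]mulr1 scalerAr -antipoder.
  rewrite tens_lift_mull; apply: tens_lift_ext => x1 x2 /=.
  by rewrite mulrA -(slice1_mulr _ x1) -mulrA tensM mulr1 mul1r.
apply: tens_lift_ext => x y.
rewrite -tens_lift_mulr -(tens_lift_comp _ (slice1 f)) -tens_lift_mull.
by rewrite tens_liftT -rmorphM /= integral_left -scalerAl mul1r.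
Qed.

Hypothesis SK : involutive S.

Lemma antipodel_op a : tens_lift (fun x y => S y * x) (D a) = eps a *: 1.
Proof.
rewrite -[in RHS](antipode1 H) -linearZ -antipodel (tens_lift_comp _ S).
by apply: tens_lift_ext => x y /=; rewrite antipodeM SK.
Qed.

Lemma antipoder_op a : tens_lift (fun x y => y * S x) (D a) = eps a *: 1.
Proof.
rewrite -[in RHS](antipode1 H) -linearZ -antipoder (tens_lift_comp _ S).
by apply: tens_lift_ext => x y /=; rewrite antipodeM SK.
Qed.

(** Both sides equal f (a1 c1) f (c2 a2), by one slide lemma each. Dually,
    f (a S b) and f (S b a) are two symmetric separability idempotents of the
    dual algebra, and such an idempotent is unique: it absorbs any other one. *)
Lemma integral_trace a c : f (a * c) = f (c * a).
Proof.
pose F (s : tensor A A) (z w : A) : A := slice2 f (tens 1 w * s) * z.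
pose G (s : tensor A A) (z w : A) : A := w * slice1 f (s * tens z 1).
have FG s z w : f (F s z w) = f (G s z w).
  rewrite /F /G; elim/tensor_ind: s => [x y|s t IH IH'].
    rewrite !tensM slice1E slice2E mul1r mulr1 -scalerAl -scalerAr !linearZ /=.
    exact: mulrC.
  by rewrite mulrDr mulrDl !linearD /= mulrDl mulrDr !linearD /= IH IH'.
have FE : f (tens_lift (F (D a)) (D c)) = f (c * a).
  have tri : trilin (fun x1 x2 z : A => f (z * a) *: (S x2 * x1)).
    by split; lin; rewrite // ![f _ * _]mulrC.
  transitivity (f (tens_lift (fun z w =>
      tens_lift (fun w1 w2 => f (w2 * a) *: (S w1 * z)) (D w)) (D c))).
    congr (f _); apply: tens_lift_ext => z w.
    rewrite /F integral_slide2 tens_lift_mulr.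
    by apply: tens_lift_ext => x y; rewrite scalerAl.
  rewrite -(comul3 H c tri) -[in RHS](counitl H c) tens_lift_mulr.
  apply: scalar_lift_eq => x z.
  rewrite -tens_lift_scale antipodel_op !linearZ /= f1 mulr1.
  by rewrite -scalerAl linearZ /= mulrC.
have GE : f (tens_lift (G (D a)) (D c)) = f (a * c).
  transitivity (f (tens_lift (fun z w =>
      tens_lift (fun w1 w2 => f (a * w1) *: (w * S w2)) (D z)) (D c))).
    congr (f _); apply: tens_lift_ext => z w.
    rewrite /G integral_slide1 tens_lift_mull.
    by apply: tens_lift_ext => x y; rewrite scalerAr.
  have tri : trilin (fun x1 x2 w : A => f (a * x1) *: (w * S x2)).
    by split; lin; rewrite // ![f _ * _]mulrC.
  rewrite (comul3 H c tri) -[in RHS](counitr H c) tens_lift_mull.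
  apply: scalar_lift_eq => z x.
  rewrite -tens_lift_scale antipoder_op !linearZ /= f1 mulr1.
  by rewrite -scalerAr linearZ /= mulrC.
by rewrite -FE -GE; apply: scalar_lift_eq => z w; rewrite FG.
Qed.
End Integral.

(** * Twisting preserves integrals *)

Section TwistIntegral.
Variables (k : fieldType) (A : falgType k) (H : hopfAlgebra A) (J : twist H).
Local Notation D := (comul H).
Local Notation eps := (counit H).
Local Notation S := (antipode H).
Local Notation Q := (twist_elt J).
Local Notation Jt := (twist_val J).
Local Notation D1 := (tens_map D (@idfun A)).
Local Notation D2 := (tens_map (@idfun A) D).
Local Notation assoc := (@tens_assoc k A A A).

Let Ju : Jt \is a GRing.unit := twist_unit J.

Lemma tens_mapM1 (s t : tensor A A) : D1 (s * t) = D1 s * D1 t.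
Proof. exact: tens_map_morph. Qed.
Lemma tens_mapM2 (s t : tensor A A) : D2 (s * t) = D2 s * D2 t.
Proof. exact: tens_map_morph. Qed.
Lemma tens_map11 : D1 1 = 1.
Proof. by rewrite -tens1 tens_mapE rmorph1. Qed.
Lemma tens_map12 : D2 1 = 1.
Proof. by rewrite -tens1 tens_mapE /= rmorph1. Qed.

Lemma twist_cocycleV :
  tens 1 Jt^-1 * D2 Jt^-1 = assoc (tens Jt^-1 1 * D1 Jt^-1).
Proof.
set y := LHS; set x := RHS; set z := D2 Jt * tens 1 Jt.
have xz : x * z = 1.
  rewrite /x /z -twist_cocycle -tens_assoc_morph mulrA -[_ * _ * D1 _]mulrA.
  rewrite -tens_mapM1 mulVr // tens_map11 mulr1 tensM mulVr // mulr1 tens1.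
  by rewrite -!tens1 tens_assoc_tens.
have zy : z * y = 1.
  rewrite /z /y mulrA -[_ * _ * tens 1 _]mulrA tensM mulrV // mul1r tens1 mulr1.
  by rewrite -tens_mapM2 mulrV // tens_map12.
by rewrite -[y]mul1r -xz -mulrA zy mulr1.
Qed.

(** Push the cocycle equation D2 J (1 (x) J) = D1 J (J (x) 1) through
    x (x) y (x) z |-> S x y (x) z; the factor D1 J contributes only the counit
    of its left leg, because S x1 x2 = eps x. *)
Lemma twist_comul_l :
  tens_lift (fun x y => tens (S x) 1 * D y) Jt = tens Q 1 * Jt^-1.
Proof.
pose P := tens_lift (fun x s => tens (S x) 1 * s) : tensor A (tensor A A) -> tensor A A.
have PE x s : P (tens x s) = tens (S x) 1 * s.
  by rewrite /P tens_liftE //; split; lin.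
have PD s t : P (s + t) = P s + P t by rewrite /P linearD.
have PM w s : P (w * tens 1 s) = P w * s.
  elim/tensor_ind: w => [x t|w w' IH IH']; last by rewrite mulrDl !PD mulrDl IH IH'.
  by rewrite tensM !PE mulr1 mulrA.
have Pa s c : P (assoc (tens s c)) = tens (conv_l H 1 s) c.
  elim/tensor_ind: s => [a b|s t IH IH']; last first.
    by rewrite tensDl linearD /= PD linearD /= tensDl IH IH'.
  by rewrite tens_assoc_tens PE conv_lE tensM mulr1 mul1r.
have Pc s t : P (assoc (D1 s * tens t 1)) =
    tens (conv_l H 1 t) (tens_lift (fun x y => eps x *: y) s).
  elim/tensor_ind: s => [a b|s s' IH IH']; last first.
    by rewrite linearD /= mulrDl !linearD /= PD IH IH' tensDr.
  rewrite tens_mapE tensM mulr1 Pa conv_lM conv_l_comul -/(slice1 eps _) slice1E.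
  rewrite tensZr -tensZl; congr tens.
  by rewrite /conv_l tens_lift_scale; apply: tens_lift_ext => u v; rewrite -scalerAr -scalerAl.
have -> : tens_lift (fun x y => tens (S x) 1 * D y) Jt = P (D2 Jt).
  elim/tensor_ind: Jt => [x y|s t IH IH']; last by rewrite !linearD /= PD IH IH'.
  by rewrite tens_mapE PE tens_liftE //; split; lin.
rewrite -[P _]mulr1 -(mulrV Ju) mulrA -PM -twist_cocycle Pc twist_counitl.
by rewrite twist_eltE.
Qed.

Hypothesis SK : involutive S.

(** The same with the inverse of the cocycle equation and
    x (x) y (x) z |-> y S x (x) z; here x2 S x1 = eps x because S is involutive. *)
Lemma twist_comul_r :
  tens_lift (fun x y => D y * tens (S x) 1) Jt^-1 = Jt * tens (S Q^-1) 1.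
Proof.
pose P := tens_lift (fun x s => s * tens (S x) 1) : tensor A (tensor A A) -> tensor A A.
have PE x s : P (tens x s) = s * tens (S x) 1.
  by rewrite /P tens_liftE //; split; lin.
have PD s t : P (s + t) = P s + P t by rewrite /P linearD.
have PM w s : P (tens 1 s * w) = s * P w.
  elim/tensor_ind: w => [x t|w w' IH IH']; last by rewrite mulrDr !PD mulrDr IH IH'.
  by rewrite tensM !PE mul1r mulrA.
have Pa s c : P (assoc (tens s c)) = tens (S (conv_r H 1 s)) c.
  elim/tensor_ind: s => [a b|s t IH IH']; last first.
    by rewrite tensDl linearD /= PD !linearD /= tensDl IH IH'.
  by rewrite tens_assoc_tens PE conv_rE tensM !mulr1 antipodeM SK.
have Pc s t : P (assoc (tens t 1 * D1 s)) =
    tens (S (conv_r H 1 t)) (tens_lift (fun x y => eps x *: y) s).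
  elim/tensor_ind: s => [a b|s s' IH IH']; last first.
    by rewrite linearD /= mulrDr !linearD /= PD IH IH' tensDr.
  rewrite tens_mapE tensM mul1r Pa conv_rM conv_r_comul -/(slice1 eps _) slice1E.
  rewrite tensZr -tensZl -linearZ; congr (tens (S _) _).
  by rewrite /conv_r tens_lift_scale; apply: tens_lift_ext => u v; rewrite -scalerAr -scalerAl.
have -> : tens_lift (fun x y => D y * tens (S x) 1) Jt^-1 = P (D2 Jt^-1).
  elim/tensor_ind: Jt^-1 => [x y|s t IH IH']; last by rewrite !linearD /= PD IH IH'.
  by rewrite tens_mapE PE tens_liftE //; split; lin.
rewrite -[P _]mul1r -(mulrV Ju) -mulrA -PM twist_cocycleV Pc -twist_eltV.
suff -> : tens_lift (fun x y => eps x *: y) Jt^-1 = 1 by [].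
have epsM : {morph tens_lift (fun x y : A => eps x *: y) : s t / s * t}.
  apply: tens_lift_morph => [|a b c d].
    by split=> u a x y; rewrite linearP ?scalerDl ?scalerA.
  by rewrite rmorphM -scalerAl -scalerAr scalerA.
by rewrite -[LHS]mulr1 -[X in _ * X](twist_counitl J) -epsM mulVr // -tens1
  -/(slice1 eps _) slice1E rmorph1 scale1r.
Qed.

Variable f : {scalar A}.
Hypothesis f_inv : forall h, slice2 f (D h) = f h *: 1.
Hypothesis f1 : f 1 = 1.

Let trace := integral_trace f_inv f1 SK.

(* L h (D c) is the right-hand side of integral_slide2 at h. *)
Let L h : {linear tensor A A -> A} :=
  tens_lift (fun x y => f (y * h) *: S x).

(** For s = p (x) q and t = x (x) y the trace property turns the left-hand side
    p h1 x f (q h2 y) into p (h1 f (y q h2)) x, where integral_slide2 replaces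
    D h by D (y q) = D y D q. *)
Lemma slice2_comul_conj h s t :
  slice2 f (s * D h * t) =
  L h (tens_lift (fun x y => tens (S x) 1 * D y) t *
       tens_lift (fun x y => D y * tens (S x) 1) s).
Proof.
have LE x y : L h (tens x y) = f (y * h) *: S x.
  rewrite /L /= tens_liftE //; split; lin => //; by rewrite ![f _ * _]mulrC.
have LM a b v : L h (tens a 1 * v * tens b 1) = S b * L h v * S a.
  elim/tensor_ind: v => [x y|v w IH IH']; last first.
    by rewrite mulrDr mulrDl !linearD /= mulrDr mulrDl IH IH'.
  by rewrite !tensM !LE mul1r mulr1 !antipodeM -scalerAr -scalerAl mulrA.
elim/tensor_ind: s => [p q|s s' IH IH']; last first.
  by rewrite !mulrDl !linearD /= mulrDr !linearD /= IH IH'.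
elim/tensor_ind: t => [x y|t t' IH IH']; last first.
  by rewrite !mulrDr !linearD /= mulrDl !linearD /= IH IH'.
rewrite !tens_liftE; try by split; lin.
rewrite mulrA -[_ * D q]mulrA -rmorphM LM !SK.
have -> : L h (D (y * q)) = slice2 f (tens 1 (y * q) * D h).
  by rewrite integral_slide2.
elim/tensor_ind: (D h) => [u v|v w IH IH']; last first.
  by rewrite !mulrDr mulrDl !linearD /= mulrDr mulrDl IH IH'.
rewrite !tensM !slice2E mul1r -scalerAr -scalerAl; congr (_ *: _).
by rewrite trace mulrA.
Qed.

Lemma slice2_twist_comul h :
  slice2 f (twist_comul J h) = f h *: S (Q * S Q^-1).
Proof.
rewrite /twist_comul slice2_comul_conj twist_comul_l twist_comul_r.
rewrite mulrA -[_ * Jt]mulrA mulVr // mulr1 tensM mulr1.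
rewrite /L /= tens_liftE ?mul1r //; split; lin => //; by rewrite ![f _ * _]mulrC.
Qed.

(** The factor S (Q S Q^-1) in the formula above is read off at h = 1, where the
    left-hand side is 1. *)
Lemma antipode_twist_elt : S Q = Q.
Proof.
have := slice2_twist_comul 1; rewrite rmorph1 -tens1 slice2E f1 !scale1r.
rewrite antipodeM SK => /esym e.
by rewrite -[LHS](mulVKr (twist_elt_unit J)) e mulr1.
Qed.

Lemma twist_integral h : slice2 f (comul (twisted J) h) = f h *: 1.
Proof.
rewrite slice2_twist_comul antipodeM SK antipode_twist_elt mulVr //.
exact: twist_elt_unit.
Qed.

Lemma twist_antipodeK : involutive (antipode (twisted J)).
Proof.
have Qu := twist_elt_unit J.
have SV : S Q^-1 = Q^-1.
  apply: (mulIr Qu); rewrite mulVr // -{2}antipode_twist_elt -antipodeM mulrV //.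
  exact: antipode1.
move=> h; rewrite /= /twist_antipode !antipodeM SK SV antipode_twist_elt.
by rewrite !mulrA mulVr // mul1r -mulrA mulVr // mulr1.
Qed.
End TwistIntegral.

(** * Cosemisimplicity and integrals *)

Section Subcoalgebras.
Variables (k : fieldType) (A : falgType k) (H : hopfAlgebra A).
Local Notation D := (comul H).
Local Notation eps := (counit H).
Local Notation S := (antipode H).
Implicit Types B E X : {vspace A}.

Lemma subcoalgebraP B :
  subcoalgebra H B <-> forall d, d \in B -> forall phi : {scalar A},
    slice1 phi (D d) \in B /\ slice2 phi (D d) \in B.
Proof.
split=> sB d dB; first by have /tensvP[s1 s2] := sB d dB.
by apply/tensvP; split=> phi; have [] := sB d dB phi.
Qed.

Lemma subcoalgebra_cap B E :
  subcoalgebra H B -> subcoalgebra H E -> subcoalgebra H (B :&: E).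
Proof.
move=> /subcoalgebraP sB /subcoalgebraP sE; apply/subcoalgebraP => d.
rewrite memv_cap => /andP[dB dE] phi; rewrite !memv_cap.
by have [-> ->] := sB d dB phi; have [-> ->] := sE d dE phi.
Qed.

Lemma subcoalgebra_sum I (r : seq I) (P : pred I) (F : I -> {vspace A}) :
  (forall i, P i -> subcoalgebra H (F i)) ->
  subcoalgebra H (\sum_(i <- r | P i) F i)%VS.
Proof.
move=> sF; elim/big_ind: _ => // [|B E /subcoalgebraP sB /subcoalgebraP sE].
  by move=> d; rewrite memv0 => /eqP->; rewrite linear0 mem0v.
apply/subcoalgebraP => _ /memv_addP[b bB [e eE ->]] phi.
have [b1 b2] := sB b bB phi; have [e1 e2] := sE e eE phi.
by rewrite !linearD /=; split; apply: memv_add.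
Qed.

(** Write 1 as a sum of d i in the simple summands B i. Comparing the components
    in B i of the slices of D 1 = 1 (x) 1 gives D (d i) = 1 (x) d i, hence
    d i = eps (d i) 1. So the line of 1 is one of the B i, and the projection
    onto it along the sum of the others, a subcoalgebra, is an integral. *)
Lemma cosemisimple_integral : cosemisimple H ->
  exists2 f : {scalar A}, forall h, slice2 f (D h) = f h *: 1 & f 1 = 1.
Proof.
case=> n [B [simB dirB sumB]].
have [d dB d1] : exists2 d, forall i, d i \in B i & 1 = \sum_i d i.
  have : (1 : A) \in (\sum_i B i)%VS by rewrite sumB memvf.
  by case/memv_sumP => d dB ->; exists d => // i; apply: dB.
have comd i : D (d i) = tens 1 (d i).
  rewrite [LHS]tensor_slice1 [RHS]tensor_slice1; apply: eq_bigr => j _.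
  congr tens; set phi := coord _ _.
  rewrite slice1E.
  have /eqP : \sum_i slice1 phi (D (d i)) = \sum_i phi 1 *: d i.
    transitivity (slice1 phi (D (\sum_i d i))); first by rewrite !linear_sum.
    by rewrite -d1 rmorph1 -tens1 slice1E d1 scaler_sumr.
  rewrite (directv_sum_unique dirB) => [/forallP/(_ i)/eqP //|l _|l _].
    have [_ /subcoalgebraP sBl _] := simB l.
    by have [] := sBl _ (dB l) phi.
  by rewrite memvZ.
have d_line i : d i \in <[1]>%VS.
  have := counitr H (d i); rewrite comd -/(slice2 eps _) slice2E => <-.
  by rewrite memvZ ?memv_line.
have [i di0] : exists i, d i != 0.
  apply/existsP; apply: contraT => /existsPn d0; have := oner_neq0 A.
  by rewrite d1 big1 ?eqxx // => i _; apply/eqP/negPn/d0.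
have line_sub : subcoalgebra H <[1]>%VS.
  move=> _ /vlineP[a ->]; rewrite linearZ /= rmorph1 -tens1 memvZ //.
  by rewrite memv_tens ?memv_line.
have Bi : <[1]>%VS = B i.
  have [_ _ /(_ _ line_sub) []] := simB i => //.
    have /vlineP[a da] := d_line i; rewrite -memvE.
    have a0 : a != 0 by apply: contraNneq di0 => a0; rewrite da a0 scale0r.
    rewrite -[1](scalerK a0); first by rewrite -da memvZ.
  by move/eqP; rewrite -dimv_eq0 dim_vline oner_neq0.
pose C := (\sum_(j | j != i) B j)%VS.
have sC : subcoalgebra H C.
  by apply: subcoalgebra_sum => j _; have [] := simB j.
have dC : (<[1]> :&: C = 0)%VS.
  by rewrite Bi; apply: (directv_sumP dirB).
have fullC : (<[1]> + C = fullv)%VS by rewrite Bi -sumB (bigD1 i).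
pose pr : 'End(A) := daddv_pi <[1]> C.
have [f f1 fC] : exists2 f : {scalar A}, f 1 = 1 & forall c, c \in C -> f c = 0.
  exists (coord [tuple 1 : A] ord0 \o pr) => [|c cC] /=.
    rewrite /pr daddv_pi_id ?memv_line //.
    by rewrite (coord_free (X := [tuple 1 : A]) ord0 ord0) // seq1_free oner_neq0.
  suff -> : pr c = 0 by rewrite linear0.
  apply: (addIr (daddv_pi C <[1]> c)).
  rewrite add0r daddv_pi_add ?fullC ?memvf //.
  by rewrite daddv_pi_id // capvC.
exists f => // h.
have : h \in (<[1]> + C)%VS by rewrite fullC memvf.
case/memv_addP => _ /vlineP[a ->] [c cC ->].
have D1 : slice2 f (D 1) = 1 by rewrite rmorph1 -tens1 slice2E f1 scale1r.
rewrite !linearD /= !linearZ /= D1 f1 mulr1 fC // addr0.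
suff -> : slice2 f (D c) = 0 by rewrite addr0.
apply: tensv_eq0 (sC c cC) => u v _ vC.
by rewrite /= slice2E fC // scale0r.
Qed.

Section Orthogonal.
Variable f : {scalar A}.
Hypothesis f_inv : forall h, slice2 f (D h) = f h *: 1.
Hypothesis f1 : f 1 = 1.
Hypothesis SK : involutive S.

Lemma integral_formC a b : f (a * S b) = f (b * S a).
Proof. by rewrite -(integral_antipode f_inv f1) antipodeM SK. Qed.

(** orth B is the orthogonal of B for the form f (a S b), as the kernel of the
    values of this form on a basis of B. *)
Definition orth_map B b : 'rV[k]_(\dim B) := \row_i f ((vbasis B)`_i * S b).

Lemma orth_map_is_linear B : linear (orth_map B).
Proof.
by move=> a x y; apply/rowP => i; rewrite !mxE !linearP /= mulrDr -scalerAr linearP.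
Qed.
HB.instance Definition _ B := GRing.isLinear.Build k A 'rV[k]_(\dim B) *:%R
  (orth_map B) (@orth_map_is_linear B).

Definition orth B : {vspace A} := lker (linfun (orth_map B)).

Lemma orthP B b : reflect (forall a, a \in B -> f (a * S b) = 0) (b \in orth B).
Proof.
rewrite memv_ker lfunE; apply: (iffP eqP) => [/rowP b0 a /coord_vbasis->|b0].
  rewrite mulr_suml linear_sum big1 //= => i _; rewrite -scalerAl linearZ /=.
  by have := b0 i; rewrite !mxE => ->; rewrite mulr0.
apply/rowP => i; rewrite !mxE b0 // vbasis_mem // mem_nth // size_tuple.
exact: ltn_ord.
Qed.

Lemma dim_orth B : (\dim {:A} <= \dim B + \dim (orth B))%N.
Proof.
rewrite -(limg_ker_dim (linfun (orth_map B)) {:A}) capfv addnC leq_add2r.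
by rewrite -[X in (_ <= X)%N]mul1n; apply: leq_trans (dimvS (subvf _)) _; rewrite dimvf.
Qed.

Lemma orth_slice2 B a b : subcoalgebra H B -> a \in B -> b \in orth B ->
  slice2 f (D a * tens 1 (S b)) = 0.
Proof.
move=> sB aB /orthP bB; pose g : {linear tensor A A -> A} := slice2 f \o (tens 1 (S b) \o* idfun).
rewrite -[LHS]/(g (D a)).
apply: tensv_eq0 (sB a aB) => u v _ vB.
by rewrite /g /= tensM slice2E bB // scale0r.
Qed.

(** The slices of D b on either side are orthogonal to B, because
    f (a S b1) b2 = a1 f (a2 S b) and b1 f (a S b2) = f (a1 S b) a2 vanish: both
    are instances of integral_antipode_r, the second one through the symmetry
    of the form. *)
Lemma orth_subcoalgebra B : subcoalgebra H B -> subcoalgebra H (orth B).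
Proof.
move=> sB; apply/subcoalgebraP => b bB phi; split; apply/orthP => a aB.
  have e : slice2 f (D b * tens 1 (S a)) = 0.
    rewrite (integral_antipode_r f_inv).
    pose g : {linear tensor A A -> A} := tens_lift (fun x y : A => f (b * S x) *: y).
    rewrite -[LHS]/(g (D a)); apply: tensv_eq0 (sB a aB) => u v uB _.
    rewrite /g /= tens_liftE; last by split; lin.
    by rewrite integral_formC (orthP _ _ bB) // scale0r.
  rewrite integral_formC tens_lift_mulr -[RHS](linear0 phi) -e.
  rewrite -[in RHS](tens_liftT (D b)) tens_lift_mulr (tens_lift_comp _ (slice2 f)).
  apply: scalar_lift_eq => x y /=.
  by rewrite tensM mulr1 slice2E -scalerAl !linearZ /= mulrC.
rewrite (tens_lift_comp _ S) tens_lift_mull -[RHS](linear0 phi).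
rewrite -(orth_slice2 sB aB bB) (integral_antipode_r f_inv).
by apply: scalar_lift_eq => x y; rewrite linearZ -scalerAr !linearZ /= mulrC.
Qed.

(** The intersection X is a subcoalgebra on which f (_ S _) is zero, so the counit
    eps x = f (x1 S x2) vanishes on X, and x = eps x1 x2 is zero. *)
Lemma cap_orth B : subcoalgebra H B -> (B :&: orth B = 0)%VS.
Proof.
move=> sB; set X := (B :&: orth B)%VS.
have sX : subcoalgebra H X by apply/subcoalgebra_cap/orth_subcoalgebra.
have eps0 x : x \in X -> eps x = 0.
  move=> xX; have := antipoder H x.
  pose g : {linear tensor A A -> A} := tens_lift (fun x y : A => x * S y).
  rewrite -/(g _) => /(congr1 f); rewrite linearZ /= f1 mulr1 => <-.
  pose g' : {linear tensor A A -> k^o} := f \o g.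
  apply: (tensv_eq0 (f := g') (t := D x) _ (sX x xX)) => u v uX vX.
  rewrite /g' /= /g /= tens_liftE; last by split; lin.
  move: uX vX; rewrite !memv_cap => /andP[uB _] /andP[_ /orthP vB].
  exact: vB.
apply/eqP; rewrite -subv0; apply/subvP => x xX; rewrite memv0 -(counitl H x).
pose g : {linear tensor A A -> A} := slice1 eps.
apply/eqP; rewrite -[LHS]/(g (D x)); apply: tensv_eq0 (sX x xX) => u v uX _.
by rewrite /g /= slice1E /= eps0 // scale0r.
Qed.

Lemma orth_compl B : subcoalgebra H B -> (B + orth B = {:A})%VS.
Proof.
move=> sB; apply/eqP; rewrite eqEdim subvf /=.
by rewrite dimv_disjoint_sum ?cap_orth // dim_orth.
Qed.

Lemma has_simple_subcoalgebra n B : (\dim B <= n)%N -> subcoalgebra H B ->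
  B != 0%VS -> exists2 X, simple_subcoalgebra H X & (X <= B)%VS.
Proof.
elim: n B => [|n IH] B; first by rewrite leqn0 dimv_eq0 => ->.
move=> dB sB B0; have [simB|nsimB] := classic (simple_subcoalgebra H B).
  by exists B.
have [E [sE EB E0 EnB]] :
    exists E, [/\ subcoalgebra H E, (E <= B)%VS, E != 0%VS & E != B].
  apply: NNPP => noE; apply: nsimB; split=> // E sE EB.
  have [->|E0] := eqVneq E 0%VS; first by left.
  have [->|EnB] := eqVneq E B; first by right.
  by case: noE; exists E.
have dE : (\dim E <= n)%N.
  rewrite -ltnS; apply: leq_trans dB.
  by rewrite ltn_neqAle dimvS // andbT (dimv_leqif_eq EB).2.
by have [X simX XE] := IH E dE sE E0; exists X => //; apply: subv_trans EB.
Qed.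

Lemma integral_decomposition n B : (\dim B <= n)%N -> subcoalgebra H B ->
  exists m (F : 'I_m -> {vspace A}),
    [/\ forall i, simple_subcoalgebra H (F i),
        \dim (\sum_i F i) = \sum_i \dim (F i) & (\sum_i F i)%VS = B].
Proof.
have nil B' : B' = 0%VS -> exists m (F : 'I_m -> {vspace A}),
    [/\ forall i, simple_subcoalgebra H (F i),
        \dim (\sum_i F i) = \sum_i \dim (F i) & (\sum_i F i)%VS = B'].
  move=> ->; exists 0%N, (fun=> 0%VS); rewrite !big_ord0 dimv0.
  by split=> // -[].
elim: n B => [|n IH] B dB sB.
  by apply: nil; apply/eqP; rewrite -dimv_eq0 -leqn0.
have [/nil //|B0] := eqVneq B 0%VS.
have [X simX XB] := has_simple_subcoalgebra dB sB B0.
have [X0 sX _] := simX.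
have dXY : (X :&: (orth X :&: B) = 0)%VS by rewrite capvA cap_orth // cap0v.
have XYB : (X + (orth X :&: B) = B)%VS.
  by rewrite vspace_modl // orth_compl // capfv.
have dY : (\dim (orth X :&: B) <= n)%N.
  rewrite -ltnS; apply: leq_trans dB.
  rewrite -[in X in (_ < X)%N]XYB dimv_disjoint_sum // -add1n leq_add2r.
  by rewrite lt0n dimv_eq0.
have [m [F [simF dimF sumF]]] := IH _ dY (subcoalgebra_cap (orth_subcoalgebra sX) sB).
exists m.+1, (fun i => oapp F X (unlift ord0 i)).
have sumE : (\sum_(i < m.+1) oapp F X (unlift ord0 i) = X + \sum_i F i)%VS.
  rewrite big_ord_recl unlift_none; congr (_ + _)%VS.
  by apply: eq_bigr => i _; rewrite liftK.
split=> [i||].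
- by case: (unliftP ord0 i) => [j _|_] /=; [apply: simF|].
- rewrite sumE sumF dimv_disjoint_sum // -sumF dimF big_ord_recl unlift_none /=.
  by congr addn; apply: eq_bigr => i _; rewrite liftK.
- by rewrite sumE sumF.
Qed.

Lemma integral_cosemisimple : cosemisimple H.
Proof.
have sA : subcoalgebra H {:A} by apply/subcoalgebraP => d _ phi; rewrite !memvf.
have [m [F [simF dimF sumF]]] := integral_decomposition (leqnn _) sA.
by exists m, F; split=> //; rewrite directvE /= dimF.
Qed.
End Orthogonal.
End Subcoalgebras.

Theorem mainTheorem4 (k : closedFieldType) (A : falgType k)
    (H : hopfAlgebra A) (J : twist H) :
  cosemisimple H -> involutive (antipode H) ->
  cosemisimple (twisted J) /\ involutive (antipode (twisted J)).
Proof.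
move=> /cosemisimple_integral[f f_inv f1] SK.
have SJK := twist_antipodeK J SK f_inv f1.
split=> //; exact: (integral_cosemisimple (twist_integral J SK f_inv f1) f1 SJK).
Qed.
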